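(* Let $G$ be a finite group with $Z(G)=1$ and let $d=d(G')$. Then $|G|\leq |G'|^{d+1}$.
   Context: $G'$ is the derived (commutator) subgroup of $G$, $Z(G)$ is the centre of $G$, and $d(H)$ denotes the minimal number of generators of a finite group $H$. *)

(* Defs.v *)
From mathcomp Require Import all_boot all_fingroup all_solvable.

Set Implicit Arguments.
Unset Strict Implicit.
Unset Printing Implicit Defensive.

(* Main.v *)
Require Import Defs.
From mathcomp Require Import all_boot all_fingroup all_solvable.

(** Write C for the centraliser of G' in G. Conjugation on d generators of G'
    determines the action of an element on G', and each generator has all its
    conjugates in G'; hence |G| <= |C| |G'|^d ([leq_card_subcent]). It remains
    to see that C is contained in G' when Z(G) = 1 ([subcent_der1_sub]).

    First, C is abelian: [[C, G], C] is trivial because [C, G] lies in G',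
    which C centralises, so by the three subgroups lemma [C, C] commutes with G
    and lies in Z(G) = 1 ([subcent_der1_abelian]). The group G then acts on C through the abelian
    group G/G', and without nontrivial fixed points. Such an action satisfies
    [C, G] = C. Indeed, look at one primary component N of C, a p-group. If all
    p'-subgroups of G centralised N, only a Sylow p-subgroup P of G would act,
    and a p-group acting on a nontrivial p-group has nontrivial fixed points.
    So some p'-subgroup Q moves N, and coprime action splits N as
    [N, Q] C_N(Q), where [N, Q] lies in G' and C_N(Q) is smaller than N but
    still normal in G, so induction applies ([norm_pgroup_sub_der1]). *)

Section SelfCentralisingDerivedSubgroup.

Import GroupScope.

(** Each element of B has all its H-conjugates in K, so its centraliser in any
    subgroup of H has index at most #|K|; the elements of B are handled one at
    a time. *)
Lemma leq_card_subcent (gT : finGroupType) (H K : {group gT}) (B : {set gT}) :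
  H \subset 'N(K) -> B \subset K -> (#|H| <= #|'C_H(B)| * #|K| ^ #|B|)%N.
Proof.
move=> nKH; have [n] := ubnP #|B|; elim: n B => // n IHn B ltBn sBK.
have [->|[x Bx]] := set_0Vmem B.
  by rewrite cards0 muln1 subset_leq_card // subsetI subxx centsC sub0set.
have sB'K : B :\ x \subset K := subset_trans (subsetDl _ _) sBK.
move: ltBn; rewrite (cardsD1 x) Bx ltnS => ltB'n.
apply: leq_trans (IHn _ ltB'n sB'K) _.
rewrite expnD expn1 mulnA leq_mul2r; apply/orP; right.
have -> : 'C_H(B) = 'C_('C_H(B :\ x))[x].
  by rewrite -{1}(setD1K Bx) centU cent_set1 setIA setIAC.
rewrite -(Lagrange (subcent1_sub x 'C_H(B :\ x))) leq_mul2l index_cent1.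
apply/orP; right; apply: subset_leq_card.
rewrite class_sub_norm ?(subsetP sBK) //.
by rewrite subIset // nKH.
Qed.

(** The three subgroups lemma, for C, G and C: both [C, G, C] and [G, C, C] are
    trivial, hence so is [C, C, G], and [C, C] is central in G. *)
Lemma subcent_der1_abelian (gT : finGroupType) (G : {group gT}) :
  'Z(G) = 1 -> abelian 'C_G(G^`(1)).
Proof.
move=> Z1; pose C := 'C_G(G^`(1))%G; change (abelian C).
have cC : [~: G^`(1), C] = 1 by apply/commG1P; rewrite centsC subsetIr.
have sCG : C \subset G by apply: subsetIl.
have CGC : [~: C, G, C] = 1.
  by apply/trivgP; rewrite -cC commSg // [G^`(1)]derg1 commSg.
have GCC : [~: G, C, C] = 1 by rewrite (commGC G).
have /commG1P cCCG := three_subgroup CGC GCC.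
apply/commG1P/trivgP; rewrite -Z1 subsetI cCCG andbT.
by rewrite (subset_trans _ (der_sub 1 G)) // derg1 commgSS.
Qed.

(** Modulo [N, A] the group A acts trivially on N, and in coprime action fixed
    points of the quotient lift to fixed points of N. *)
Lemma coprime_sub_commg_cent (gT : finGroupType) (A N : {group gT}) :
    A \subset 'N(N) -> coprime #|N| #|A| -> abelian N ->
  N \subset [~: N, A] * 'C_N(A).
Proof.
move=> nNA coNA abN.
have sRN : [~: N, A] \subset N by rewrite commg_subl.
have nRN : N \subset 'N([~: N, A]) := commg_norml N A.
have nRA : A \subset 'N([~: N, A]) := commg_normr A N.
rewrite -(quotientSK _ nRN).
rewrite (coprime_quotient_cent sRN nRA coNA) ?abelian_sol //.
by rewrite subsetI subxx quotient_cents2r.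
Qed.

(** The order of G divides that of its intersection with H, one prime at a
    time. *)
Lemma sub_of_Sylows (gT : finGroupType) (G H : {group gT}) :
    (forall p, exists2 P : {group gT}, p.-Sylow(G) P & P \subset H) ->
  G \subset H.
Proof.
move=> sylH; apply/setIidPl/eqP; rewrite eqEcard subsetIl /=.
apply: dvdn_leq => //; apply/dvdn_partP => // p _.
have [P sylP sPH] := sylH p.
by rewrite -(card_Hall sylP) cardSg // subsetI (pHall_sub sylP).
Qed.

(** Induction on the order of N, splitting off [N, Q] for a p'-subgroup Q of G
    that does not centralise N. The hypothesis that N centralises G' is what
    keeps C_N(Q) normal in G. *)
Lemma norm_pgroup_sub_der1 (gT : finGroupType) (p : nat) (G N : {group gT}) :
    'Z(G) = 1 -> p.-group N -> abelian N -> N <| G -> N \subset 'C(G^`(1)) ->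
  N \subset G^`(1).
Proof.
move=> Z1; have [n] := ubnP #|N|; elim: n N => // n IHn N ltNn pN abN nNG cNG'.
have [->|ntN] := eqsVneq N 1; first exact: sub1G.
have [sNG nNG'] := andP nNG.
case: (altP (@forallP _ (fun Q : {group gT} =>
    (p^'.-group Q && (Q \subset G)) ==> (Q \subset 'C(N))))) => [cNp' | ].
  (* A nontrivial fixed point z of P in N is centralised by a Sylow subgroup
     for every prime, so it is central in G. *)
  have [P sylP] := Sylow_exists p G; have sPG := pHall_sub sylP.
  have sNP : N \subset P.
    by rewrite (subset_trans _ (pcore_sub_Hall sylP)) // pcore_max.
  have nNP : N <| P := normalS sNP sPG nNG.
  have /trivgPn[z /setIP[Nz /centerP[_ cPz]] ntz] :=
    meet_center_nil (pgroup_nil (pHall_pgroup sylP)) nNP ntN.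
  case/eqP: ntz; apply/set1gP; rewrite -Z1 inE (subsetP sNG z Nz) -sub_cent1 /=.
  apply: sub_of_Sylows => q; have [->|neqp] := eqVneq q p.
    by exists P; rewrite // sub_cent1; apply/centP.
  have [Q sylQ] := Sylow_exists q G; exists Q => //.
  have p'Q : p^'.-group Q.
    by apply: sub_in_pnat (pHall_pgroup sylQ) => r _ /eqnP->.
  have := cNp' Q; rewrite p'Q (pHall_sub sylQ) => /= cNQ.
  by rewrite sub_cent1 (subsetP _ z Nz) // centsC.
case/forallPn=> Q; rewrite negb_imply => /andP[/andP[p'Q sQG] ncNQ].
have nNQ := subset_trans sQG nNG'.
have coNQ : coprime #|N| #|Q| := pnat_coprime pN p'Q.
apply: subset_trans (coprime_sub_commg_cent _ _ _ nNQ coNQ abN) _.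
rewrite mul_subG //; first exact: commgSS.
(* K contains G', so it is normal in G; as N centralises G', replacing Q by K
   does not change the centraliser in N. *)
set K := (Q <*> G^`(1))%G.
have nKG : K <| G.
  by rewrite sub_der1_normal ?joing_subr // join_subG sQG der_sub.
have CNK : 'C_N(Q) = 'C_N(K).
  by rewrite /= centY setIA; apply/esym/setIidPl; rewrite subIset ?cNG'.
apply: IHn; rewrite ?(abelianS (subsetIl _ _)) ?(pgroupS (subsetIl _ _)) //.
- apply: leq_trans (proper_card _) _; last exact: (ltNn : #|N| <= n).
  by rewrite properE subsetIl subsetI subxx centsC.
- rewrite /normal /= CNK subIset ?sNG //= normsI ?norms_cent ?normal_norm //.
- by rewrite subIset ?cNG'.
Qed.

(** The Sylow subgroups of the abelian group 'C_G(G^`(1)) are its p-cores, which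
    are characteristic and therefore normal in G. *)
Lemma subcent_der1_sub (gT : finGroupType) (G : {group gT}) :
  'Z(G) = 1 -> 'C_G(G^`(1)) \subset G^`(1).
Proof.
move=> Z1; have abC := subcent_der1_abelian _ _ Z1.
have nCG : 'C_G(G^`(1)) <| G.
  by rewrite /normal subsetIl normsI ?normG ?norms_cent ?gFnorm.
apply: sub_of_Sylows => p; exists 'O_p('C_G(G^`(1)))%G.
  exact: nilpotent_pcore_Hall (abelian_nil abC).
have sOC := pcore_sub p 'C_G(G^`(1)).
apply: (norm_pgroup_sub_der1 _ p) => //=.
- exact: pcore_pgroup.
- exact: abelianS sOC abC.
- exact: char_normal_trans (pcore_char _ _) nCG.
- exact: subset_trans sOC (subsetIr _ _).
Qed.

End SelfCentralisingDerivedSubgroup.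

Theorem theorem6 (gT : finGroupType) (G : {group gT}) (d : nat) :
  ('Z(G) = 1)%g -> d = ('m(G^`(1)))%g -> #|G| <= #|(G^`(1))%g| ^ (d + 1).
Proof.
move=> Z1 ->; have [B defB <-] := grank_witness G^`(1).
have sBG' : B \subset G^`(1)%g by rewrite -defB subset_gen.
have nG'G := normal_norm (der_normal 1 G).
apply: leq_trans (leq_card_subcent _ _ _ _ nG'G sBG') _.
rewrite addn1 expnS leq_mul2r; apply/orP; right.
rewrite -cent_gen defB; apply: subset_leq_card.
exact: subcent_der1_sub.
Qed.
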